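(* Suppose that $R$ is a left continuous ring. Then $R$ is a right strongly exchange ring.
   Context: Rings are associative with identity. A left module $M$ is continuous if it satisfies: (C1) every submodule of $M$ is essential in a direct summand of $M$; (C2) any submodule of $M$ that is isomorphic to a direct summand of $M$ is itself a direct summand of $M$. A ring $R$ is left continuous if it is continuous as a left module over itself. A right coprime pair in $R$ is a pair of elements $a,b\in R$ with $aR+bR=R$. Two right coprime pairs $(a,b)$, $(a',b')$ are identified when $aR=a'R$ and $bR=b'R$; $\langle a,b\rangle$ denotes the equivalence class, $\mathrm{RCP}(R)$ the set of all classes, and a pair $(a',b')$ with $\langle a',b'\rangle=\langle a,b\rangle$ is called a pair of generators of $\langle a,b\rangle$. $\mathrm{RCP}(R)$ is partially ordered by $\langle a,b\rangle\le\langle a',b'\rangle$ iff $aR\subseteq a'R$ and $bR\subseteq b'R$. A compatible descending chain of right coprime pairs is a family $\{p_\alpha\mid\alpha<\kappa\}\subseteq \mathrm{RCP}(R)$ ($\kappa$ an ordinal, $p_\beta\le p_\alpha$ for $\alpha<\beta<\kappa$) such that there exist a pair of generators $(a_\alpha,b_\alpha)$ of $p_\alpha$ for each $\alpha<\kappa$, and elements $r_{\alpha\beta},s_{\alpha\beta}\in R$ for $\alpha<\beta<\kappa$, with $a_\beta=a_\alpha r_{\alpha\beta}$ and $b_\beta=b_\alpha s_{\alpha\beta}$ for all $\alpha<\beta<\kappa$, and $r_{\alpha\beta}=r_{\alpha\gamma}r_{\gamma\beta}$, $s_{\alpha\beta}=s_{\alpha\gamma}s_{\gamma\beta}$ for all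 $\alpha<\gamma<\beta<\kappa$. A minimal lower bound of a chain is a lower bound of the chain in $\mathrm{RCP}(R)$ that is a minimal element of the poset $\mathrm{RCP}(R)$. The ring $R$ is right strongly exchange if every compatible descending chain of right coprime pairs of $R$ has a minimal lower bound. *)

(* Defs.v *)
From HB Require Import structures.
From mathcomp Require Import all_boot all_order all_algebra.
From mathcomp Require Import boolp classical_sets functions.

Set Implicit Arguments.
Unset Strict Implicit.
Unset Printing Implicit Defensive.

Import Order.TTheory GRing.Theory.
Local Open Scope ring_scope.
Local Open Scope quotient_scope.
Local Open Scope classical_set_scope.

Section Modules.
Variables (R : pzRingType) (M : lmodType R).
Implicit Types N D K : set M.

Definition submodule N : Prop := GRing.submod_closed [in N].

Definition direct_summand D : Prop :=
  submodule D /\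
  exists D', [/\ submodule D',
                 [set x + y | x in D & y in D'] = [set: M] &
                 D `&` D' = [set 0]].

Definition essential_in N D : Prop :=
  [/\ submodule N, submodule D, N `<=` D &
      forall K, submodule K -> K `<=` D -> N `&` K = [set 0] -> K = [set 0]].

(* Only the values of [f] on [N] matter: [f] is a linear bijection from the
   submodule [N] onto the submodule [D], extended arbitrarily to [M]. *)
Definition submodule_iso N D : Prop :=
  exists f : M -> M,
    (forall (c : R) (u v : M), N u -> N v ->
       f (c *: u + v) = c *: f u + f v) /\
    set_bij N D f.

Definition C1 : Prop :=
  forall N, submodule N -> exists2 D, direct_summand D & essential_in N D.

Definition C2 : Prop :=
  forall N D, submodule N -> direct_summand D -> submodule_iso N D ->
    direct_summand N.

Definition continuous_module : Prop := C1 /\ C2.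

End Modules.

(* Rings are [pzRingType]s, so the zero ring is not excluded. *)
Definition left_continuous (R : pzRingType) : Prop := continuous_module R^o.

Fact RCP_display : Order.disp_t.
Proof. exact: (Order.Disp tt tt). Qed.

Section RightCoprimePairs.
Variable R : pzRingType.

Definition rideal (a : R) : set R := [set a * r | r in [set: R]].

Definition right_coprime (a b : R) : Prop :=
  [set x + y | x in rideal a & y in rideal b] = [set: R].

Definition rcpair := {ab : R * R | `[< right_coprime ab.1 ab.2 >]}.

Definition rcpair_eqv (p q : rcpair) : bool :=
  `[< rideal (val p).1 = rideal (val q).1 /\
      rideal (val p).2 = rideal (val q).2 >].

Lemma rcpair_eqv_refl : reflexive rcpair_eqv.
Proof. by move=> p; apply/asboolP. Qed.

Lemma rcpair_eqv_sym : symmetric rcpair_eqv.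
Proof. by move=> p q; apply/idP/idP => /asboolP[? ?]; apply/asboolP. Qed.

Lemma rcpair_eqv_trans : transitive rcpair_eqv.
Proof.
move=> q p s /asboolP[pq1 pq2] /asboolP[qs1 qs2]; apply/asboolP.
by rewrite pq1 pq2.
Qed.

Canonical rcpair_equiv :=
  EquivRel rcpair_eqv rcpair_eqv_refl rcpair_eqv_sym rcpair_eqv_trans.

Definition RCP := {eq_quot rcpair_eqv}.
HB.instance Definition _ := EqQuotient.on RCP.
HB.instance Definition _ := Choice.on RCP.

Definition rcp_class (a b : R) (ab : right_coprime a b) : RCP :=
  \pi_{eq_quot rcpair_eqv}
    (exist (fun xy => `[< right_coprime xy.1 xy.2 >]) (a, b) (asboolT ab)).

(* [RCP_le] compares chosen representatives; by [rcp_class_le] below the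
   choice is immaterial. *)
Definition RCP_le (p q : RCP) : bool :=
  `[< rideal (val (repr p)).1 `<=` rideal (val (repr q)).1 /\
      rideal (val (repr p)).2 `<=` rideal (val (repr q)).2 >].

Lemma RCP_le_refl : reflexive RCP_le.
Proof. by move=> p; apply/asboolP; split. Qed.

Lemma RCP_le_anti : antisymmetric RCP_le.
Proof.
move=> p q /andP[/asboolP[pq1 pq2] /asboolP[qp1 qp2]].
rewrite -[p]reprK -[q]reprK; apply/eqmodP; apply/asboolP.
by split; apply/seteqP.
Qed.

Lemma RCP_le_trans : transitive RCP_le.
Proof.
move=> q p s /asboolP[pq1 pq2] /asboolP[qs1 qs2]; apply/asboolP; split.
- exact: subset_trans qs1.
- exact: subset_trans qs2.
Qed.

HB.instance Definition _ :=
  Order.Le_isPOrder.Build RCP_display RCP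
    RCP_le_refl RCP_le_anti RCP_le_trans.

Lemma rcp_class_eq a b a' b' (ab : right_coprime a b)
    (ab' : right_coprime a' b') :
  rcp_class ab = rcp_class ab' <->
  rideal a = rideal a' /\ rideal b = rideal b'.
Proof. by split=> [/eqmodP /asboolP | h]; last by apply/eqmodP; apply/asboolP. Qed.

Lemma rcp_class_le a b a' b' (ab : right_coprime a b)
    (ab' : right_coprime a' b') :
  (rcp_class ab <= rcp_class ab')%O <->
  rideal a `<=` rideal a' /\ rideal b `<=` rideal b'.
Proof.
have repr_rideal x y (xy : right_coprime x y) :
    rideal (val (repr (rcp_class xy))).1 = rideal x /\
    rideal (val (repr (rcp_class xy))).2 = rideal y.
  by have /eqmodP /asboolP := reprK (rcp_class xy).
have [e1 e2] := repr_rideal _ _ ab; have [e1' e2'] := repr_rideal _ _ ab'.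
rewrite /Order.le /= /RCP_le e1 e2 e1' e2'.
by split=> [/asboolP | h]; last exact/asboolP.
Qed.

Definition generators (p : RCP) (a b : R) : Prop :=
  exists ab : right_coprime a b, rcp_class ab = p.

(* An ordinal is presented as a well-founded total order [I] whose elements are
   the indices below it; [I] may be empty. *)
Definition compatible_descending_chain d (I : orderType d) (p : I -> RCP)
    : Prop :=
  (forall i j : I, (i < j)%O -> (p j <= p i)%O) /\
  exists (a b : I -> R) (r s : I -> I -> R),
    [/\ forall i, generators (p i) (a i) (b i),
        forall i j : I, (i < j)%O -> a j = a i * r i j /\ b j = b i * s i j &
        forall i k j : I, (i < k)%O -> (k < j)%O ->
          r i j = r i k * r k j /\ s i j = s i k * s k j].

(* The minimality is in the whole poset [RCP], not only among lower bounds. *)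
Definition minimal_lower_bound d (I : orderType d) (p : I -> RCP) (q : RCP)
    : Prop :=
  (forall i, (q <= p i)%O) /\
  (forall q' : RCP, (q' <= q)%O -> q' = q).

Definition right_strongly_exchange : Prop :=
  forall d (I : orderType d) (p : I -> RCP),
    well_founded (fun i j : I => (i < j)%O) ->
    compatible_descending_chain p ->
    exists q : RCP, minimal_lower_bound p q.

End RightCoprimePairs.

(* Main.v *)
Require Import Defs.
From mathcomp Require Import all_boot all_order all_algebra.
From mathcomp Require Import boolp classical_sets functions.

(** For elements [a], [b] of a left continuous ring [R] write [l(a)], [l(b)]
    for their left annihilators.  The key point is that an idempotent [e] with
    [l(a) <= l(e)] already lies in [a R]: right multiplication by [a] embeds
    [R e] as a direct summand [R e a] (C2), which meets [R (1 - e) a] trivially,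
    so that a projection kills [(1 - e) a] and fixes [e a].  For a chain of
    right coprime pairs [(a_i, b_i)] the left ideals [A = U l(a_i)] and
    [B = U l(b_i)] are independent, hence some idempotent [e] satisfies
    [A e = 0] and [B (1 - e) = 0]; then [e] is in every [a_i R] and [1 - e] in
    every [b_i R], and the pair [(e, 1 - e)] is minimal in [RCP(R)]. *)

Set Implicit Arguments.
Unset Strict Implicit.
Unset Printing Implicit Defensive.

Import Order.TTheory GRing.Theory.
Local Open Scope ring_scope.
Local Open Scope quotient_scope.
Local Open Scope classical_set_scope.

Lemma submoduleP (R : pzRingType) (M : lmodType R) (N : set M) :
  submodule N <-> N 0 /\ forall c u v, N u -> N v -> N (c *: u + v).
Proof.
split=> [[N0 NL]|[N0 NL]]; split.
- by rewrite inE in N0.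
- move=> c u v Nu Nv; have := NL c u v; rewrite !inE; exact.
- by rewrite inE.
- by move=> c u v; rewrite !inE; exact: NL.
Qed.

Section LeftIdeals.
Variable R : pzRingType.
Implicit Types (e f g x y z : R) (N D : set R^o).

Definition left_span x : set R^o := [set c * x | c in [set: R]].

Lemma submodule_left_span x : submodule (left_span x).
Proof.
apply/submoduleP; split; first by exists 0; rewrite ?mul0r.
move=> c _ _ [u _ <-] [v _ <-]; exists (c * u + v) => //.
by rewrite mulrDl -mulrA.
Qed.

Lemma submodule_mull N c x : submodule N -> N x -> N (c * x).
Proof.
by move=> /submoduleP[N0 NL] Nx; have := NL c x 0 Nx N0; rewrite addr0.
Qed.

Lemma submoduleI N D : submodule N -> submodule D -> submodule (N `&` D).
Proof.
move=> /submoduleP[N0 NL] /submoduleP[D0 DL]; apply/submoduleP.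
by split=> // c u v [Nu Du] [Nv Dv]; split; [exact: NL | exact: DL].
Qed.

Lemma left_span_idem e x : e * e = e -> left_span e x <-> x * e = x.
Proof.
move=> ee; split=> [[c _ <-]|xe]; first by rewrite -mulrA ee.
by exists x.
Qed.

(** The idempotent is the component of [1] in [D]. If [1 = e + e'] along the decomposition and [x]
    is in [D], then [x - x * e = x * e'] lies in both summands, so right multiplication by [e] fixes
    [D]. *)
Lemma direct_summandP D :
  direct_summand D <-> exists2 e, e * e = e & D = left_span e.
Proof.
split=> [[sD [D' [sD' DD' DI]]]|[e ee ->]]; last first.
  split; first exact: submodule_left_span.
  exists (left_span (1 - e)); split; first exact: submodule_left_span.
    rewrite -subTset => x _; exists (x * e); first by exists x.
    exists (x * (1 - e)); first by exists x.
    by rewrite -mulrDr addrC subrK mulr1.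
  apply/seteqP; split=> [x [/(left_span_idem _ ee) xe [c _ cx]]|x ->].
    by rewrite /= -xe -cx -mulrA mulrBl mul1r ee subrr mulr0.
  by split; exists 0; rewrite ?mul0r.
have [e De [e' De' ee']] : [set x + y | x in D & y in D'] (1 : R^o).
  by rewrite DD'.
have fixD x : D x -> x * e = x.
  move=> Dx; apply/eqP; rewrite -subr_eq0 -opprB oppr_eq0; apply/eqP.
  suff : (D `&` D') (x - x * e : R^o) by rewrite DI.
  split.
    have /submoduleP[_ DL] := sD.
    have := DL (-1) _ _ (submodule_mull x sD De) Dx.
    by rewrite scaleN1r addrC.
  have -> : x - x * e = x * e'.
    have {1}<- : x * (e + e') = x by rewrite [e + e']ee' mulr1.
    by rewrite mulrDr addrAC subrr add0r.
  exact: submodule_mull.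
exists e; first exact: fixD.
apply/seteqP; split=> x; first by move=> /fixD <-; exists x.
by move=> [c _ <-]; exact: submodule_mull.
Qed.

Definition independent N D := N `&` D = [set 0].

Lemma independentP N D : submodule N -> submodule D ->
  independent N D <-> forall x, N x -> D x -> x = 0.
Proof.
move=> /submoduleP[N0 _] /submoduleP[D0 _]; split=> [ND x Nx Dx|ND].
  by have : (N `&` D) x by []; rewrite ND.
by apply/seteqP; split=> [x [Nx Dx]|x ->]; [exact: ND | split].
Qed.

(** Essentiality is used twice: [N] meets [D'] in a submodule of [D'] that is independent of [N'],
    hence zero; then [D] meets [D'] in a submodule of [D] that is independent of [N], hence zero. *)
Lemma essential_independent N D N' D' :
  essential_in N D -> essential_in N' D' ->
  independent N N' -> independent D D'.
Proof.
move=> [sN sD ND essN] [sN' sD' ND' essN'] NN'.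
apply: essN; first exact: submoduleI; first by move=> x [].
rewrite (setIC D) setIA; apply: essN'; first 1 last.
- by move=> x [[_ ?] _].
- apply/independentP => //; first exact/submoduleI/sD/submoduleI.
  by move=> x N'x [[Nx _] _]; apply: (proj1 (independentP sN sN') NN').
- exact/submoduleI/sD/submoduleI.
Qed.

Lemma essential_refl N : submodule N -> essential_in N N.
Proof. by move=> sN; split=> // K _ KN; rewrite setIidr. Qed.

(** Left annihilators grow along the chain, so their union is directed. The disjunct [t = 0] keeps
    it nonempty when [I] is empty. *)
Lemma submodule_ann_chain d (I : orderType d) (a : I -> R) (r : I -> I -> R) :
  (forall i j, (i < j)%O -> a j = a i * r i j) ->
  submodule ([set t | t = 0 \/ exists i, t * a i = 0] : set R^o).
Proof.
move=> ar; apply/submoduleP.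
have ann_le i j t : (i <= j)%O -> t * a i = 0 -> t * a j = 0.
  rewrite le_eqVlt => /predU1P[<- //|/ar ->] tai.
  by rewrite mulrA tai mul0r.
split; first by left.
move=> c u v [->|[i ui]] [->|[j vj]].
- by left; rewrite scaler0 addr0.
- by right; exists j; rewrite scaler0 add0r.
- by right; exists i; rewrite addr0 -mulrA ui mulr0.
right; exists (Order.max i j).
by rewrite mulrDl -mulrA (ann_le _ _ _ _ ui) ?(ann_le _ _ _ _ vj)
  ?mulr0 ?addr0 // le_max lexx ?orbT.
Qed.

(** Write [1 = a * u + b * v]. Left multiplication by [e] fixes [a * u] and kills [b * v], whence
    [e = a * u] and [1 - e = b * v]. *)
Lemma minimal_idem_pair e a b :
  e * e = e -> right_coprime a b ->
  rideal a `<=` rideal e -> rideal b `<=` rideal (1 - e) ->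
  rideal e `<=` rideal a /\ rideal (1 - e) `<=` rideal b.
Proof.
move=> ee ab ae be.
have [_ [u _ <-] [_ [v _ <-] uv]] :
    [set x + y | x in rideal a & y in rideal b] (1 : R) by rewrite ab.
have [s _ es] : rideal e (a * u) by apply: ae; exists u.
have [t _ et] : rideal (1 - e) (b * v) by apply: be; exists v.
have eE : e = a * u.
  rewrite -[LHS]mulr1 -uv mulrDr -es -et !mulrA ee mulrBr mulr1 ee subrr mul0r.
  by rewrite addr0.
have e'E : 1 - e = b * v by rewrite {1}eE -uv addrC addKr.
split=> _ [c _ <-]; last by rewrite e'E; exists (v * c); rewrite ?mulrA.
by rewrite eE; exists (u * c); rewrite ?mulrA.
Qed.

Hypothesis hR : left_continuous R.

(** Right multiplication by [x] maps [R g] isomorphically onto [R g x], which by C2 is [R h] for an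
    idempotent [h = w * g * x]. Then [g * x * w * g * x = g * x], and injectivity cancels the last
    [x]. *)
Lemma mulr_inj_split g x :
  g * g = g -> (forall t, t * g * x = 0 -> t * g = 0) ->
  exists z, g * x * z = g.
Proof.
move=> gg ginj.
have gx_inj u v : u * g = u -> v * g = v -> u * x = v * x -> u = v.
  move=> ug vg uv; apply/eqP; rewrite -subr_eq0; apply/eqP.
  have -> : u - v = (u - v) * g by rewrite mulrBl ug vg.
  by apply: ginj; rewrite mulrBl ug vg mulrBl uv subrr.
(* C2 wants the isomorphism to run from the submodule to the summand, hence this inverse of right
   multiplication by [x]; it takes the default value 0 outside [R g x]. *)
pose inv t := xget 0 [set s : R | s * g = s /\ s * x = t].
have invP t : left_span (g * x) t -> inv t * g = inv t /\ inv t * x = t.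
  move=> [c _ <-]; rewrite /inv; case: xgetP => [s -> //|/(_ (c * g)) []].
  by rewrite /= -!mulrA gg.
have sgx := submodule_left_span (g * x).
have invK s : s * g = s -> inv (s * x) = s.
  move=> sg; have sx : left_span (g * x) (s * x) by exists s; rewrite ?mulrA ?sg.
  by have [? ?] := invP _ sx; apply: gx_inj.
have /direct_summandP[h hh hE] : direct_summand (left_span (g * x)).
  apply: (proj2 hR _ (left_span g)) => //; first by apply/direct_summandP; exists g.
  exists inv; split=> [c u v Nu Nv|].
    have [ug ux] := invP _ Nu; have [vg vx] := invP _ Nv.
    rewrite -[in LHS]ux -[in LHS]vx.
    have -> : c *: (inv u * x : R^o) + inv v * x = (c * inv u + inv v) * x.
      by rewrite mulrDl -mulrA.
    by apply: invK; rewrite mulrDl -mulrA ug vg.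
  split.
  - by move=> t /invP[<- _]; exists (inv t).
  - move=> u v /set_mem/invP[_ ux] /set_mem/invP[_ vx] uv.
    by rewrite -ux uv.
  - move=> s /(left_span_idem _ gg) sg; exists (s * x); last exact: invK.
    by exists s; rewrite // mulrA sg.
have [w _ wh] : left_span (g * x) h by rewrite hE; exists 1; rewrite ?mul1r.
have gxh : g * x * h = g * x.
  by apply/(left_span_idem _ hh); rewrite -hE; exists 1; rewrite ?mul1r.
exists (w * g); rewrite mulrA; apply: gx_inj => //; first by rewrite -mulrA gg.
by rewrite -2!mulrA wh.
Qed.

(** On [R g], right multiplication by [1 - f] has kernel inside [R f], so it is injective and
    splits; its splitting [z] yields [e = (1 - f) * z * g]. *)
Lemma separating_idem f g :
  f * f = f -> g * g = g -> independent (left_span f) (left_span g) ->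
  exists e, [/\ e * e = e, f * e = 0 & g * e = g].
Proof.
move=> ff gg /(independentP (submodule_left_span f) (submodule_left_span g)) fg.
have [|z gz] := @mulr_inj_split g (1 - f) gg.
  move=> t; rewrite mulrBr mulr1 => /subr0_eq tgf.
  by apply: fg; [exists (t * g) | exists t].
have ge : g * ((1 - f) * z * g) = g by rewrite !mulrA gz gg.
exists ((1 - f) * z * g); split=> //.
- by rewrite -[LHS]mulrA ge.
- by rewrite !mulrA mulrBr mulr1 ff subrr !mul0r.
Qed.

(** C1 encloses [N] and [D] in summands in which they are essential; these are still independent,
    which reduces the claim to idempotents. *)
Lemma separating_idem_submodule N D :
  submodule N -> submodule D -> independent N D ->
  exists e, [/\ e * e = e, forall t, N t -> t * e = 0
                         & forall t, D t -> t * e = t].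
Proof.
move=> sN sD ND; have [N' sN' eN'] := proj1 hR N sN.
have [D' sD' eD'] := proj1 hR D sD.
have N'D' := essential_independent eN' eD' ND.
have [f ff N'E] := proj1 (direct_summandP _) sN'.
have [g gg D'E] := proj1 (direct_summandP _) sD'.
have [|e [ee fe ge]] := separating_idem ff gg; first by rewrite -N'E -D'E.
exists e; split=> // t.
- case: eN' => _ _ NN' _ /NN'; rewrite N'E => -[c _ <-].
  by rewrite -mulrA fe mulr0.
- case: eD' => _ _ DD' _ /DD'; rewrite D'E => -[c _ <-].
  by rewrite -mulrA ge.
Qed.

Lemma idem_mem_rideal e a :
  e * e = e -> (forall t, t * a = 0 -> t * e = 0) -> rideal a e.
Proof.
move=> ee ae.
have [|z eaz] := @mulr_inj_split e a ee.
  by move=> t /ae; rewrite -mulrA ee.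
have [||| f [ff kf fixf]] := @separating_idem_submodule
    (left_span ((1 - e) * a)) (left_span (e * a)).
- exact: submodule_left_span.
- exact: submodule_left_span.
- apply/independentP; [exact: submodule_left_span..|].
  move=> x [c _ cx] [d _ dx].
  (* An element annihilating [a] also annihilates [e]; here this leaves [d * e = 0]. *)
  have : (c * (1 - e) - d * e) * a = 0.
    by rewrite mulrBl -!mulrA cx dx subrr.
  move=> /ae; rewrite mulrBl -!mulrA mulrBl mul1r ee subrr mulr0 sub0r.
  by move=> /eqP; rewrite oppr_eq0 -dx mulrA => /eqP ->; rewrite mul0r.
(* Since [f] kills [(1 - e) * a] and fixes [e * a], [a * f = e * a], and [z] then carries this to
   [e]. *)
exists (f * z) => //; rewrite mulrA.
have -> : a * f = e * a.
  have {1}-> : a = (1 - e) * a + e * a by rewrite -mulrDl subrK mul1r.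
  rewrite mulrDl kf; last by exists 1; rewrite ?mul1r.
  by rewrite add0r fixf //; exists 1; rewrite ?mul1r.
exact: eaz.
Qed.

End LeftIdeals.

Theorem corollary3p12 (R : pzRingType) (hR : left_continuous R) :
  right_strongly_exchange R.
Proof.
move=> d I p _ [_ [a [b [r [s [gen step _]]]]]].
have sA := submodule_ann_chain (fun i j ij => proj1 (step i j ij)).
have sB := submodule_ann_chain (fun i j ij => proj2 (step i j ij)).
have [|e [ee Ae Be]] := separating_idem_submodule hR sA sB.
  apply/independentP => // t [-> //|[i tai]] [-> //|[j tbj]].
  (* At the later of the two indices [t] annihilates both generators, hence all of [R] by
     coprimality. *)
  have [k [tak tbk]] : exists k, t * a k = 0 /\ t * b k = 0.
    have [ij|ji|ij] := ltgtP i j; last by exists i; rewrite {2}ij.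
      by exists j; rewrite (proj1 (step _ _ ij)) mulrA tai mul0r.
    by exists i; rewrite (proj2 (step _ _ ji)) mulrA tbj mul0r.
  have [ab _] := gen k.
  have [_ [u _ <-] [_ [v _ <-] uv]] :
    [set x + y | x in rideal (a k) & y in rideal (b k)] (1 : R) by rewrite ab.
  by rewrite -[t]mulr1 -uv mulrDr !mulrA tak tbk !mul0r addr0.
have e'e' : (1 - e) * (1 - e) = 1 - e.
  by rewrite mulrBr mulr1 mulrBl mul1r ee subrr subr0.
have ea i : rideal (a i) e.
  by apply: (idem_mem_rideal hR) => // t tai; apply: Ae; right; exists i.
have eb i : rideal (b i) (1 - e).
  apply: (idem_mem_rideal hR) => // t tbi.
  by rewrite mulrBr mulr1 Be ?subrr //; right; exists i.
have rsub x y : rideal x y -> rideal y `<=` rideal x.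
  by move=> [c _ <-] _ [c' _ <-]; exists (c * c'); rewrite ?mulrA.
have cop : right_coprime e (1 - e).
  rewrite /right_coprime -subTset => x _; exists (e * x); first by exists x.
  exists ((1 - e) * x); first by exists x.
  by rewrite -mulrDl addrC subrK mul1r.
exists (rcp_class cop); split=> [i|q].
  have [ab <-] := gen i; apply/rcp_class_le.
  by split; apply: rsub.
(* A chosen representative puts [q] in the form [rcp_class ab'], to which the comparison lemmas
   apply. *)
rewrite -[q]reprK; case: (repr q) => -[a' b'] /= ab.
have ab' := asboolW ab; rewrite (_ : \pi _ = rcp_class ab'); last first.
  by congr (\pi _); apply: val_inj.
move=> /rcp_class_le[a'e b'e].
have [ea' eb'] := minimal_idem_pair ee ab' a'e b'e.
by apply/rcp_class_eq; split; apply/seteqP.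
Qed.
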